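(* Let $R$ be a totally ordered set and let $P$ be a pairwise-locally strongly connected poset admitting an $R$-grading. Then the antichain cutsets of $P$ are exactly the level sets of $P$.
   Context: A maximal chain is a chain not properly contained in any other. An antichain cutset of $P$ is a set meeting each maximal chain of $P$ in exactly one element. A poset $Q$ is strongly connected if any two maximal chains of $Q$ are joined by a finite sequence of maximal chains in which consecutive chains have symmetric difference of cardinality two. $P$ is pairwise-locally strongly connected if for all $x,y\in P$ some closed interval $[a,b]$ of $P$ containing $x,y$ is strongly connected. An $R$-grading of $P$ is a map $\rho:P\to R$ whose restriction to each maximal chain of $P$ is an order isomorphism onto $R$; the level sets are the nonempty sets $\{x\in P:\rho(x)=r\}$, $r\in R$. *)

(* Defs.v *)
From mathcomp Require Export all_boot all_order.
From mathcomp Require Export boolp classical_sets functions cardinality.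

Set Implicit Arguments.
Unset Strict Implicit.
Unset Printing Implicit Defensive.

Import Order.TTheory.

Local Open Scope classical_set_scope.
Local Open Scope card_scope.
Local Open Scope order_scope.

Section PosetNotions.
Context {dP : Order.disp_t} {P : porderType dP}.
Implicit Types (A C D Q : set P).

Definition chain C : Prop := total_on C (fun x y => x <= y).

(* Maximal chains of the subposet [Q] of [P], with the induced order;
   the maximal chains of [P] itself are those of [setT]. *)
Definition maximal_chain Q C : Prop :=
  [/\ C `<=` Q, chain C & forall D, D `<=` Q -> chain D -> ~ C `<` D].

Definition antichain_cutset A : Prop :=
  forall C, maximal_chain [set: P] C -> exists! x, (A `&` C) x.

(* The finite sequence is [c 0, ..., c n]; the values of [c] beyond [n] are
   irrelevant. *)
Definition strongly_connected Q : Prop :=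
  forall C D, maximal_chain Q C -> maximal_chain Q D ->
  exists (n : nat) (c : nat -> set P),
    [/\ c 0%N = C, c n = D,
        forall i, (i <= n)%N -> maximal_chain Q (c i)
      & forall i, (i < n)%N -> c i `+` c i.+1 #= `I_2].

Definition closed_interval (a b : P) : set P := [set z | a <= z <= b].

End PosetNotions.

Definition pairwise_locally_strongly_connected
    {dP : Order.disp_t} (P : porderType dP) : Prop :=
  forall x y : P, exists a b : P,
    [/\ closed_interval a b x, closed_interval a b y
      & strongly_connected (closed_interval a b)].

Section Gradings.
Context {dR : Order.disp_t} {R : orderType dR}.
Context {dP : Order.disp_t} {P : porderType dP}.
Implicit Types (rho : P -> R).

Definition is_grading rho : Prop :=
  forall C : set P, maximal_chain [set: P] C ->
    set_bij C [set: R] rho /\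
    (forall x y, C x -> C y -> (rho x <= rho y) = (x <= y)).

Definition level_set rho (A : set P) : Prop :=
  A !=set0 /\ exists r : R, A = [set x | rho x = r].

End Gradings.

(* Main.v *)
Require Import Defs.

(** A maximal chain of an interval [a, b] can be exchanged inside a maximal
    chain of P through a and b, so a path of maximal chains of [a, b] lifts to a
    path of maximal chains of P. Two consecutive maximal chains of P differ in a
    single element on each side; since the grading is bijective on both, these
    two elements have the same grade. Hence the unique point of an antichain
    cutset keeps its grade along the path. *)

Set Implicit Arguments.
Unset Strict Implicit.
Unset Printing Implicit Defensive.

Import Order.TTheory.

Local Open Scope classical_set_scope.
Local Open Scope card_scope.
Local Open Scope order_scope.

Lemma card_eq2_unique (T : Type) (S : set T) (x y z : T) :
  S #= `I_2 -> S x -> S y -> S z -> x <> y -> z <> x -> z = y.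
Proof.
move=> /eq_cardSP[p _ /eq_cardSP[q _]]; rewrite II0 card_eq0 => /eqP Spq.
have S2 t : S t -> t = p \/ t = q.
  move=> St; have [->|tp] := pselect (t = p); first by left.
  right; apply: contrapT => tq.
  by have : (S `\ p `\ q) t by []; rewrite Spq.
by move=> /S2[]-> /S2[]-> /S2[]->.
Qed.

Section MaximalChains.
Context {dP : Order.disp_t} {P : porderType dP}.
Implicit Types (C D Q : set P).

Lemma chainU1 C x : chain C -> (forall y, C y -> x >=< y) -> chain (x |` C).
Proof.
move=> cC xC y z [->|Cy] [->|Cz]; first by left.
- exact/orP/xC.
- by apply/orP; rewrite orbC; exact: xC.
- exact: cC.
Qed.

(** Maximality can be tested one point at a time: a point comparable with all of [C] could be
    adjoined to [C], and every point of a larger chain is comparable with all of [C]. *)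
Lemma maximal_chainP Q C :
  maximal_chain Q C <->
  [/\ C `<=` Q, chain C
    & forall x, Q x -> (forall y, C y -> x >=< y) -> C x].
Proof.
split=> -[CQ cC maxC]; split => //.
- move=> x Qx xC; apply: contrapT => nCx.
  apply: (maxC (x |` C)); [by move=> y [->|/CQ]|exact: chainU1|].
  by split=> [y|/(_ x)]; [right|move/(_ (or_introl erefl))].
- move=> D DQ cD [CD]; apply => x Dx.
  by apply: maxC => [|y /CD Dy]; [exact: DQ|exact/orP/cD].
Qed.

Lemma sub_maximal_chain Q C :
  C `<=` Q -> chain C -> exists2 D, maximal_chain Q D & C `<=` D.
Proof.
move=> CQ cC.
have [|D [[DQ cD] maxD]] :=
  (* Zorn's lemma also has to cover the empty family, whose union need not contain [C]; hence the
     condition is put on [D] united with [C]. *)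
  @Zorn_bigcup P [set D | D `<=` Q /\ chain (D `|` C)].
  move=> F FP Ftot; split=> [x [D /FP[DQ _]]|]; first exact: DQ.
  move=> x y [[D FD Dx]|Cx] [[E FE Ey]|Cy].
  - have [DE|ED] := Ftot _ _ FD FE.
    + by apply: (FP _ FE).2; left => //; exact: DE.
    + by apply: (FP _ FD).2; left => //; exact: ED.
  - by apply: (FP _ FD).2; [left|right].
  - by apply: (FP _ FE).2; [right|left].
  - exact: cC.
exists (D `|` C); last exact: subsetUr.
split=> //; first by rewrite subUset.
move=> E EQ cE [DCE nEDC]; apply: (maxD E).
- split=> [x Dx|ED]; first by apply: DCE; left.
  by apply: nEDC => x /ED; left.
- by split=> //; rewrite setUidl// => x Cx; apply: DCE; right.
Qed.

Lemma maximal_chain_through Q x : Q x -> exists2 C, maximal_chain Q C & C x.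
Proof.
move=> Qx; have [||C maxC xC] := @sub_maximal_chain Q [set x].
- by move=> _ ->.
- by move=> _ _ -> ->; left.
- by exists C => //; exact: xC.
Qed.

Lemma maximal_chain_interval_ends a b C : a <= b ->
  maximal_chain (closed_interval a b) C -> C a /\ C b.
Proof.
move=> ab /maximal_chainP[CI cC maxC]; split; apply: maxC.
- by rewrite /closed_interval/= lexx.
- by move=> y /CI/andP[ay _]; rewrite /Order.comparable ay.
- by rewrite /closed_interval/= ab lexx.
- by move=> y /CI/andP[_ yb]; rewrite /Order.comparable yb orbT.
Qed.

Lemma maximal_chain_exchange a b C D : a <= b ->
  maximal_chain setT C -> C a -> C b ->
  maximal_chain (closed_interval a b) D ->
  maximal_chain setT ((C `\` closed_interval a b) `|` D).
Proof.
move=> ab /maximal_chainP[_ cC maxC] Ca Cb maxD'.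
have [Da Db] := maximal_chain_interval_ends ab maxD'.
have /maximal_chainP[DI cD maxD] := maxD'.
(* Such a point lies below [a] or above [b]. Thus the parts of a chain inside and outside the
   interval do not constrain each other. *)
have outside z : z >=< a -> z >=< b -> ~ closed_interval a b z ->
    forall y, closed_interval a b y -> z >=< y.
  move=> /orP za /orP zb nIz y /andP[ay yb].
  case: za => [za|az]; first by rewrite /Order.comparable (le_trans za ay).
  case: zb => [zb|bz]; first by case: nIz; apply/andP.
  by rewrite /Order.comparable (le_trans yb bz) orbT.
have outC z : C z -> ~ closed_interval a b z ->
    forall y, closed_interval a b y -> z >=< y.
  by move=> Cz; apply: outside; apply/orP; exact: cC.
apply/maximal_chainP; split=> // [x y|x _ xF].
- move=> [[Cx nIx]|Dx] [[Cy nIy]|Dy].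
  + exact: cC.
  + by apply/orP; apply: outC => //; exact: DI.
  + by apply/orP; rewrite orbC; apply: outC => //; exact: DI.
  + exact: cD.
- have [Ix|nIx] := pselect (closed_interval a b x).
    by right; apply: maxD => // y Dy; apply: xF; right.
  (* As [D] contains [a] and [b], [x] is comparable with both, hence also with the discarded points
     of [C] in the interval. *)
  left; split=> //; apply: maxC => // y Cy.
  have [Iy|nIy] := pselect (closed_interval a b y).
    by apply: outside Iy => //; apply: xF; right.
  by apply: xF; left.
Qed.

End MaximalChains.

Section Cutsets.
Context {dR : Order.disp_t} {R : orderType dR}.
Context {dP : Order.disp_t} {P : porderType dP}.
Variable rho : P -> R.
Hypothesis rho_grading : is_grading rho.
Implicit Types (A C D : set P).

Lemma grading_inj C x y : maximal_chain setT C ->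
  C x -> C y -> rho x = rho y -> x = y.
Proof.
by move=> /rho_grading[[_ inj _] _] Cx Cy; apply: inj; exact: mem_set.
Qed.

Lemma grading_surj C r : maximal_chain setT C -> exists2 x, C x & rho x = r.
Proof. by move=> /rho_grading[[_ _ /(_ r I)]]. Qed.

Lemma cutset_unique A C x y : antichain_cutset A -> maximal_chain setT C ->
  A x -> C x -> A y -> C y -> x = y.
Proof.
move=> cutA /cutA[w [_ w_uniq]] Ax Cx Ay Cy.
by rewrite -(w_uniq x)// -(w_uniq y).
Qed.

Lemma cutset_step A C D x y : antichain_cutset A ->
  maximal_chain setT C -> maximal_chain setT D -> C `+` D #= `I_2 ->
  A x -> C x -> A y -> D y -> rho x = rho y.
Proof.
move=> cutA maxC maxD CD2 Ax Cx Ay Dy.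
have [Dx|nDx] := pselect (D x).
  by rewrite (cutset_unique cutA maxD Ax Dx Ay Dy).
have [Cy|nCy] := pselect (C y).
  by rewrite (cutset_unique cutA maxC Ax Cx Ay Cy).
(* The point [t] is not in [C], where only [x] has its grade. So [x], [y] and [t] lie in a
   two-element set, and [x] differs from both others, which forces [t = y]. *)
have [t Dt tx] := grading_surj (rho x) maxD.
have nCt : ~ C t.
  by move=> Ct; apply: nDx; rewrite -(grading_inj maxC Ct Cx tx).
rewrite -tx (card_eq2_unique CD2 (x := x) (y := y) (z := t)) //.
- by left.
- by right.
- by right.
- by move=> xy; rewrite xy in nDx.
- by move=> tx'; rewrite tx' in nCt.
Qed.

Lemma cutset_interval A a b x y : antichain_cutset A ->
  strongly_connected (closed_interval a b) ->
  closed_interval a b x -> closed_interval a b y ->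
  A x -> A y -> rho x = rho y.
Proof.
move=> cutA scI Ix Iy Ax Ay.
have ab : a <= b by case/andP: Ix => /le_trans; apply.
have [C maxC Cx] := maximal_chain_through Ix.
have [D maxD Dy] := maximal_chain_through Iy.
have [n [c [c0 cn maxc cstep]]] := scI _ _ maxC maxD.
have [_ cC _] := maxC.
(* [E] passes through [a] and [b] because [C] does, so any [c i] can be exchanged into it. *)
have [E maxE CE] := sub_maximal_chain (@subsetT _ C) cC.
have [/CE Ea /CE Eb] := maximal_chain_interval_ends ab maxC.
pose F i := (E `\` closed_interval a b) `|` c i.
have maxF i : (i <= n)%N -> maximal_chain setT (F i).
  by move=> /maxc; exact: maximal_chain_exchange.
have F2 i : (i < n)%N -> F i `+` F i.+1 #= `I_2.
  (* The common part of [F i] and [F i.+1] outside the interval cancels and is disjoint from every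
     [c i]. *)
  move=> ltin; suff -> : F i `+` F i.+1 = c i `+` c i.+1 by exact: cstep.
  have [ciI _ _] := maxc i (ltnW ltin); have [cjI _ _] := maxc i.+1 ltin.
  apply/seteqP; split=> z.
  + move=> [[[Ez|cz] nF]|[[Ez|cz] nF]].
    * by case: nF; left.
    * by left; split=> // cjz; apply: nF; right.
    * by case: nF; left.
    * by right; split=> // cjz; apply: nF; right.
  + move=> [[cz ncz]|[cz ncz]]; [left|right].
    * by split; [right|move=> [[_ /(_ (ciI _ cz))]|]].
    * by split; [right|move=> [[_ /(_ (cjI _ cz))]|]].
have grade_F i : (i <= n)%N -> forall w, A w -> F i w -> rho x = rho w.
  elim: i => [_ w Aw Fw|i IH ltin w Aw Fw].
    congr rho; apply: (cutset_unique cutA (maxF 0%N (leq0n n))) => //.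
    by right; rewrite c0.
  (* The cutset meets the previous chain as well, in a point [v] that links the grade of [x] to that
     of [w]. *)
  have [v [[Av Fv] _]] := cutA _ (maxF i (ltnW ltin)).
  rewrite (IH (ltnW ltin) v Av Fv).
  exact: (cutset_step cutA (maxF i (ltnW ltin)) (maxF i.+1 ltin) (F2 i ltin)).
by apply: (grade_F n (leqnn n)) => //; right; rewrite cn.
Qed.

End Cutsets.

Theorem theorem2p2 (dR dP : Order.disp_t) (R : orderType dR)
    (P : porderType dP) (rho : P -> R) :
  pairwise_locally_strongly_connected P ->
  is_grading rho ->
  forall A : set P, antichain_cutset A <-> level_set rho A.
Proof.
move=> scP grho A; split.
- move=> cutA.
  (* Extending the empty chain needs no point of [P]; the cutset then provides one. *)
  have [||C0 maxC0 _] := @sub_maximal_chain _ P setT set0; [by []|by []|].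
  have [x [[Ax _] _]] := cutA _ maxC0.
  have Arho y : A y -> rho y = rho x.
    move=> Ay; have [a [b [Iy Ix scI]]] := scP y x.
    exact: (cutset_interval grho cutA scI).
  split; first by exists x.
  exists (rho x); apply/seteqP; split=> [y /Arho //|z /= zx].
  (* The cutset meets a maximal chain through [z] in a point of the same grade as [z], which must be
     [z] itself. *)
  have [C maxC Cz] := @maximal_chain_through _ P setT z I.
  have [w [[Aw Cw] _]] := cutA _ maxC.
  have <- // : w = z.
  by apply: (grading_inj grho maxC) => //; rewrite zx Arho.
- move=> [_ [r ->]] C maxC.
  have [x Cx xr] := grading_surj grho r maxC.
  exists x; split=> // y [yr Cy].
  by apply: (grading_inj grho maxC) => //; rewrite xr yr.
Qed.
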